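(* Let $R$ be a von Neumann regular ring and suppose that $R$ satisfies the closure extension property, i.e. any $R$-isomorphism between two right ideals of $R$ can be extended to an isomorphism between their essential closures in $R$. Then $R$ is separative.
   Context: Rings are associative with identity. A ring $R$ is (von Neumann) regular if for every $a\in R$ there exists $b\in R$ with $a=aba$; such a ring is right nonsingular. In a right nonsingular ring $R$, the essential closure in $R$ of a right ideal $I$ is the unique largest right ideal of $R$ containing $I$ as an essential submodule. A nonsingular ring $R$ is said to have the closure extension property if any (right) $R$-module isomorphism between two right ideals of $R$ can be extended to an isomorphism between their essential closures in $R$. A ring $R$ is separative if for any finitely generated projective right $R$-modules $M$ and $N$, the isomorphisms $M\oplus N\cong M\oplus M\cong N\oplus N$ imply $M\cong N$. *)

(* Defs.v *)
From HB Require Import structures.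
From mathcomp Require Import all_boot all_order all_algebra.
From mathcomp Require Import classical_sets functions.

Set Implicit Arguments.
Unset Strict Implicit.
Unset Printing Implicit Defensive.

Import GRing.Theory.
Local Open Scope ring_scope.
Local Open Scope classical_set_scope.

Definition von_neumann_regular (R : pzRingType) : Prop :=
  forall a : R, exists b : R, a = a * b * a.

Section RightIdeals.
Variable R : pzRingType.
Implicit Types (I J K E : set R) (f : R -> R).

(* Closure under opposites follows from [x * -1]. *)
Definition right_ideal I : Prop :=
  [/\ I 0, forall x y, I x -> I y -> I (x + y)
    & forall x r, I x -> I (x * r)].

Definition essential_in I J : Prop :=
  I `<=` J /\
  forall K, right_ideal K -> K `<=` J -> I `&` K = [set 0] -> K = [set 0].

(* Such an [E] is unique when it exists; it exists for every right ideal of a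
   right nonsingular ring, in particular of a regular ring. *)
Definition essential_closure I E : Prop :=
  [/\ right_ideal E, essential_in I E
    & forall J, right_ideal J -> essential_in I J -> J `<=` E].

(* A map from I to J is represented by a total function on R, of which only the
   values on I matter. *)
Definition right_ideal_iso I J f : Prop :=
  [/\ {in I &, {morph f : x y / x + y}},
      {in I, forall x r, f (x * r) = f x * r}
    & set_bij I J f].

Definition closure_extension_property : Prop :=
  forall I J f, right_ideal I -> right_ideal J -> right_ideal_iso I J f ->
  forall I' J', essential_closure I I' -> essential_closure J J' ->
  exists2 g, right_ideal_iso I' J' g & {in I, g =1 f}.

End RightIdeals.

(* Right R-modules are left modules over the converse ring R^c. *)
Notation rmodType R := (lmodType R^c).

Section Modules.
Variable R : pzRingType.
Implicit Types M N : rmodType R.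

Definition mod_iso M N : Prop := exists f : {linear M -> N}, bijective f.

Definition finitely_generated M : Prop :=
  exists (n : nat) (v : 'I_n -> M),
    forall x, exists c : 'I_n -> R^c, x = \sum_(i < n) c i *: v i.

Definition projective M : Prop :=
  forall (A B : rmodType R) (p : {linear A -> B}) (h : {linear M -> B}),
    (forall y, exists x, p x = y) ->
    exists h' : {linear M -> A}, forall x, p (h' x) = h x.

Definition separative : Prop :=
  forall M N, finitely_generated M -> projective M ->
    finitely_generated N -> projective N ->
    mod_iso (M * N)%type (M * M)%type ->
    mod_iso (M * M)%type (N * N)%type ->
    mod_iso M N.

End Modules.

(* Main.v *)
Require Import Defs.
From HB Require Import structures.
From mathcomp Require Import all_boot all_order all_algebra.
From mathcomp Require Import generic_quotient.
From mathcomp Require Import boolp classical_sets functions.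

(** Up to isomorphism of essential submodules ([ess_iso], that is, isomorphism
    of injective hulls), a module absorbs any [Z] that embeds in it infinitely
    many times independently.  Suppose [A + C = B + C] with [C] embedded in [A]
    and in [B].  Iterated refinement [A_n = D_n + A_(n+1)],
    [B_n = D_n + B_(n+1)], [C_n = A_(n+1) + C_(n+1) = B_(n+1) + C_(n+1)] splits
    [A] and [B], up to essential submodules, into [D = sum of the D_n] plus
    remainders [A_oo] and [B_oo]; each remainder embeds in every [A_n]
    (resp. [B_n]), and all of these sit independently in [C], so [B] absorbs
    [A_oo] and [A] absorbs [B_oo].  Hence
    [A ~ A + B_oo ~ D + A_oo + B_oo ~ B + A_oo ~ B].  When [A], [B] are direct
    summands of [R], closure extension turns this into [A = B], and the
    refinement property of the monoid of finitely generated projectives reduces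
    separativity to that case. *)

Set Implicit Arguments.
Unset Strict Implicit.
Unset Printing Implicit Defensive.

Import GRing.Theory.
Local Open Scope ring_scope.
Local Open Scope classical_set_scope.
Local Open Scope quotient_scope.

(** * Regular matrices and refinement of idempotents *)

Section RegularMatrices.
Variable S : pzRingType.

Definition has_qinv m n (x : 'M[S]_(m, n)) := exists y, x *m y *m x = x.

(** The defect [z = x - x y x] factors both as [a x] and as [x b], so [z = z w z = x (b w a) x], and
    adding [b w a] to [y] corrects it. *)
Lemma qinv_lift m n (x : 'M[S]_(m, n)) (y : 'M[S]_(n, m)) :
  has_qinv (x - x *m y *m x) -> has_qinv x.
Proof.
set z := _ - _ => -[w wP].
have [a zl] : exists a, z = a *m x.
  by exists (1%:M - x *m y); rewrite mulmxBl mul1mx.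
have [b zr] : exists b, z = x *m b.
  by exists (1%:M - y *m x); rewrite mulmxBr mulmx1 mulmxA.
exists (y + b *m w *m a).
rewrite mulmxDr mulmxDl !mulmxA -zr -[z *m w *m a *m x]mulmxA -zl wP.
by rewrite addrC subrK.
Qed.

(** When [y] is a quasi-inverse of the left block, the defect in [qinv_lift] has zero left block,
    and a quasi-inverse of its right block suffices. *)
Lemma qinv_row_mx m n1 n2 :
  (forall x : 'M[S]_(m, n1), has_qinv x) ->
  (forall x : 'M[S]_(m, n2), has_qinv x) ->
  forall x : 'M[S]_(m, n1 + n2), has_qinv x.
Proof.
move=> reg1 reg2 x; rewrite -(hsubmxK x).
move: (lsubmx x) (rsubmx x) => x1 x2 {x}.
have [y yP] := reg1 x1; apply: (@qinv_lift _ _ _ (col_mx y 0)).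
rewrite mul_row_col mulmx0 addr0 mul_mx_row yP opp_row_mx add_row_mx subrr.
have [w wP] := reg2 (x2 - x1 *m y *m x2).
by exists (col_mx 0 w); rewrite mul_row_col mulmx0 add0r mul_mx_row mulmx0 wP.
Qed.

Lemma qinv_col_mx m1 m2 n :
  (forall x : 'M[S]_(m1, n), has_qinv x) ->
  (forall x : 'M[S]_(m2, n), has_qinv x) ->
  forall x : 'M[S]_(m1 + m2, n), has_qinv x.
Proof.
move=> reg1 reg2 x; rewrite -(vsubmxK x).
move: (usubmx x) (dsubmx x) => x1 x2 {x}.
have [y yP] := reg1 x1; apply: (@qinv_lift _ _ _ (row_mx y 0)).
rewrite -mulmxA mul_row_col mul0mx addr0 mul_col_mx mulmxA yP opp_col_mx.
rewrite add_col_mx subrr.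
have [w wP] := reg2 (x2 - x2 *m (y *m x1)).
exists (row_mx 0 w).
by rewrite -mulmxA mul_row_col mulmx0 add0r mul_col_mx mul0mx mulmxA wP.
Qed.

Lemma matrix_regular m n (x : 'M[S]_(m, n)) :
  von_neumann_regular S -> has_qinv x.
Proof.
move=> reg; have reg11 (y : 'M[S]_1) : has_qinv y.
  have [b bP] := reg (y 0 0); exists b%:M.
  by rewrite (mx11_scalar y) -!scalar_mxM -bP.
elim: m => [|m IHm] in x *; first by exists 0; rewrite [x]flatmx0 !mulmx0.
have regR k (y : 'M[S]_(1, k)) : has_qinv y.
  elim: k => [|k IHk] in y *; first by exists 0; rewrite [y]thinmx0 !mulmx0.
  exact: (@qinv_row_mx 1 1 k).
exact: (@qinv_col_mx 1 m n).
Qed.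

Lemma matrix_ring_regular n :
  von_neumann_regular S -> von_neumann_regular 'M[S]_n.
Proof. by move=> reg x; have [y yP] := matrix_regular x reg; exists y. Qed.

End RegularMatrices.

Section RingRefinement.
Variable T : pzRingType.

Definition orth_idem (e f : T) :=
  [/\ e * e = e, f * f = f, e * f = 0 & f * e = 0].

(** On idempotents, Murray-von Neumann equivalence: [eT] and [fT] are isomorphic, and equivalently
    [Te] and [Tf]. *)
Definition ring_eqv (e f : T) := exists x y, x * y = e /\ y * x = f.

Lemma orth_idemD e f : orth_idem e f -> (e + f) * (e + f) = e + f.
Proof.
by case=> ee ff ef fe; rewrite mulrDl !mulrDr ee ff ef fe addr0 add0r.
Qed.

Lemma orth_idemB e f : e * e = e -> f * f = f -> e * f = f -> f * e = f ->
  orth_idem f (e - f).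
Proof.
by move=> ee ff ef fe; split;
  rewrite ?mulrBl ?mulrBr ?ee ?ff ?ef ?fe ?subrr ?subr0.
Qed.

(* Write [P = pT], etc., and [X = P + Q = M + N].  With [z = qm] and a reflexive
   inverse [w] of [z], the image of [M] in [Q] is [Q1 = zwT], and [P1], the
   intersection of [M] and [P], is the kernel of [z] on [M]; complements [P2]
   and [Q2] then satisfy [X = M + P2 + Q2], so that [N = P2 + Q2]. *)
Lemma ring_refinement p q m n : von_neumann_regular T ->
  orth_idem p q -> orth_idem m n -> p + q = m + n ->
  exists p1 p2 q1 q2 m1 m2,
    [/\ orth_idem p1 p2 /\ p = p1 + p2, orth_idem q1 q2 /\ q = q1 + q2,
        orth_idem m1 m2 /\ m = m1 + m2, ring_eqv m1 p1 /\ ring_eqv m2 q1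
      & orth_idem p2 q2 /\ ring_eqv n (p2 + q2)].
Proof.
move=> reg [pp qq pq qp] [mm nn mn nm] h.
have [z zE] : exists z, z = q * m by exists (q * m).
have qz : q * z = z by rewrite zE mulrA qq.
have zm : z * m = z by rewrite zE -mulrA mm.
have [w [zw mw wq ww]] : exists w, [/\ z * w * z = z, m * w = w, w * q = w
    & w * z * w = w].
  have [v vP] := reg z.
  have [u uE] : exists u, u = m * v * q by exists (m * v * q).
  have zuz : z * u * z = z.
    by rewrite uE !mulrA zm -(mulrA (z * v)) qz -vP.
  exists (u * z * u); split; last 1 first.
  - by rewrite !mulrA; do 2!rewrite -(mulrA u) -(mulrA u) zuz; rewrite mulrA.
  - by rewrite !mulrA zuz zuz.
  - by rewrite uE !mulrA mm.
  - by rewrite -mulrA uE -(mulrA _ q q) qq.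
have qw : q * w = z * w by rewrite -{1}mw mulrA -zE.
have wm : w * m = w * z by rewrite -{1}wq -mulrA -zE.
have [m1 m1E] : exists m1, m1 = m - w * z by exists (m - w * z).
have [p1 p1E] : exists p1, p1 = m1 * p by exists (m1 * p).
have [q1 q1E] : exists q1, q1 = z * w by exists (z * w).
have mq1 : orth_idem (w * z) m1.
  rewrite m1E; apply: orth_idemB => //; first by rewrite mulrA ww.
    by rewrite mulrA mw.
  by rewrite -mulrA zm.
have [wzi m1i _ _] := mq1.
have qm1 : q * m1 = 0 by rewrite m1E mulrBr mulrA qw zw -zE subrr.
have hm : (p + q) * m = m by rewrite h mulrDl mm nm addr0.
have hw : (p + q) * w = w by rewrite -mw mulrA hm.
have hm1 : (p + q) * m1 = m1 by rewrite m1E mulrBr hm mulrA hw.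
have pm1 : p * m1 = m1 by rewrite -{2}hm1 mulrDl qm1 addr0.
have p1i : p1 * p1 = p1 by rewrite p1E mulrA -(mulrA m1) pm1 m1i.
have pp1 : p * p1 = p1 by rewrite p1E mulrA pm1.
have p1p : p1 * p = p1 by rewrite p1E -mulrA pp.
have p1m1 : p1 * m1 = m1 by rewrite p1E -mulrA pm1 m1i.
have m1p1 : m1 * p1 = p1 by rewrite p1E mulrA m1i.
have q1i : q1 * q1 = q1 by rewrite q1E mulrA zw.
have qq1 : q * q1 = q1 by rewrite q1E mulrA qz.
have q1q : q1 * q = q1 by rewrite q1E -mulrA wq.
have o1 : orth_idem p1 (p - p1) by apply: orth_idemB.
have o2 : orth_idem q1 (q - q1) by apply: orth_idemB.
have [p2 p2E] : exists p2, p2 = p - p1 by exists (p - p1).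
have [q2 q2E] : exists q2, q2 = q - q1 by exists (q - q1).
rewrite -p2E in o1; rewrite -q2E in o2.
have [_ p2i _ _] := o1; have [_ q2i _ _] := o2.
have pp2 : p * p2 = p2 by rewrite p2E mulrBr pp pp1.
have p2p : p2 * p = p2 by rewrite p2E mulrBl pp p1p.
have qq2 : q * q2 = q2 by rewrite q2E mulrBr qq qq1.
have q2q : q2 * q = q2 by rewrite q2E mulrBl qq q1q.
have p2q2 : p2 * q2 = 0 by rewrite -p2p -qq2 mulrA -(mulrA p2) pq mulr0 mul0r.
have q2p2 : q2 * p2 = 0 by rewrite -q2q -pp2 mulrA -(mulrA q2) qp mulr0 mul0r.
exists p1, p2, q1, q2, m1, (w * z); split.
- by split=> //; rewrite p2E addrC subrK.
- by split=> //; rewrite q2E addrC subrK.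
- by case: mq1 => ? ? ? ?; split; last by rewrite m1E subrK.
- by split; [exists p1, m1|exists w, z].
- split=> //.
  (* [t] is the projection along [M] onto [P2 + Q2]. *)
  have [t tE] : exists t, t = p2 - p2 * w + q2 by exists (p2 - p2 * w + q2).
  have q2z : q2 * z = 0 by rewrite q2E mulrBl qz q1E zw subrr.
  have p2m1 : p2 * m1 = 0 by rewrite p2E mulrBl pm1 p1m1 subrr.
  have tm : t * m = 0.
    have -> : t * m = p2 * m1 + q2 * z.
      by rewrite tE mulrDl mulrBl -mulrA wm m1E mulrBr zE (mulrA q2) q2q.
    by rewrite p2m1 q2z addr0.
  have p2qr : p2 * q = 0 by rewrite -p2p -mulrA pq mulr0.
  have q2pr : q2 * p = 0 by rewrite -q2q -mulrA qp mulr0.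
  have wp : w * p = 0 by rewrite -wq -mulrA qp mulr0.
  have th : t * (p + q) = t.
    rewrite tE !(mulrDl, mulrDr) !mulNr p2p q2q -!(mulrA p2) wq wp p2qr q2pr.
    by rewrite mulr0 oppr0 !(addr0, add0r).
  have tn : t * n = t by rewrite -{2}th h mulrDr tm add0r.
  have nt : n * t = n.
    have nw : n * w = 0 by rewrite -mw mulrA nm mul0r.
    have np1 : n * p1 = 0.
      by rewrite p1E m1E mulrA mulrBr nm mulrA nw mul0r subrr mul0r.
    have nh : n * (p + q) = n by rewrite h mulrDr nm nn add0r.
    have -> : t = (p + q) - p1 - w + p1 * w.
      rewrite tE p2E q2E mulrBl q1E -qw -{4}hw mulrDl !opprD !opprK.
      by rewrite !addrA [LHS](ACl (1*5*2*3*6*4)).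
    by rewrite mulrDr !mulrBr nh mulrA np1 nw mul0r !subr0 addr0.
  have [g gE] : exists g, g = p2 + q2 by exists (p2 + q2).
  have gt : g * t = t.
    rewrite gE tE !(mulrDl, mulrDr) !mulrN !mulrA p2i q2i p2q2 q2p2 mul0r.
    by rewrite oppr0 !addr0 add0r.
  have tg : t * g = g.
    rewrite gE tE !(mulrDl, mulrDr) !mulNr p2i q2i p2q2 q2p2 addr0 add0r.
    have -> : p2 * w * p2 = 0.
      by rewrite -{2}pp2 mulrA -(mulrA p2) wp mulr0 mul0r.
    have -> : p2 * w * q2 = 0.
      by rewrite -mulrA q2E mulrBr wq q1E mulrA ww subrr mulr0.
    by rewrite oppr0 !addr0 ?add0r.
  (* On [X], [n] and [t] have the same kernel [M] ([t n = t], [n t = n]), while [t] and [g] have the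
     same image ([g t = t], [t g = g]); this links [n] to [g]. *)
  rewrite -gE; exists (n * g), t; split.
    by rewrite -mulrA gt.
  by rewrite mulrA tn tg.
Qed.

End RingRefinement.

(** * The monoid of finitely generated projectives *)

(** An idempotent matrix stands for the finitely generated projective left module spanned by its
    rows; all sizes are gathered in one type, so that isomorphism classes form a quotient. *)
Record idmx (S : pzRingType) :=
  Idmx { idim : nat; imx : 'M[S]_idim; imxP : imx *m imx = imx }.

Section IdempotentMatrices.
Variable S : pzRingType.
Implicit Types e f g : idmx S.

HB.instance Definition _ := gen_eqMixin (idmx S).
HB.instance Definition _ := gen_choiceMixin (idmx S).

Definition mx_eqv m n (e : 'M[S]_m) (f : 'M[S]_n) :=
  exists x y, x *m y = e /\ y *m x = f.

Definition idmx_eqv e f := mx_eqv (imx e) (imx f).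

Lemma idmx_eqv_refl e : idmx_eqv e e.
Proof. by exists (imx e), (imx e); rewrite imxP. Qed.

Lemma idmx_eqv_sym e f : idmx_eqv e f -> idmx_eqv f e.
Proof. by case=> x [y [xy yx]]; exists y, x. Qed.

Lemma idmx_eqv_trans e f g : idmx_eqv e f -> idmx_eqv f g -> idmx_eqv e g.
Proof.
case=> x [y [xy yx]] [z [w [zw wz]]]; exists (x *m z), (w *m y); split.
- by rewrite -mulmxA (mulmxA z) zw -yx !mulmxA xy -mulmxA xy imxP.
- by rewrite -mulmxA (mulmxA y) yx -zw !mulmxA wz -mulmxA wz imxP.
Qed.

Lemma idmx_sum_subproof e f :
  block_mx (imx e) 0 0 (imx f) *m block_mx (imx e) 0 0 (imx f)
  = block_mx (imx e) 0 0 (imx f).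
Proof. by rewrite mulmx_block !(mulmx0, mul0mx, addr0, add0r) !imxP. Qed.

Definition idmx_sum e f := Idmx (idmx_sum_subproof e f).

Lemma idmx_sum_eqv e e' f f' :
  idmx_eqv e e' -> idmx_eqv f f' -> idmx_eqv (idmx_sum e f) (idmx_sum e' f').
Proof.
case=> x [y [xy yx]] [z [w [zw wz]]].
exists (block_mx x 0 0 z), (block_mx y 0 0 w).
by rewrite !mulmx_block !(mulmx0, mul0mx, addr0, add0r) xy yx zw wz.
Qed.

Lemma idmx_sumC e f : idmx_eqv (idmx_sum e f) (idmx_sum f e).
Proof.
exists (block_mx 0 (imx e) (imx f) 0), (block_mx 0 (imx f) (imx e) 0).
by rewrite !mulmx_block !(mulmx0, mul0mx, addr0, add0r) !imxP.
Qed.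

Lemma mx_eqv_cast m n (mn : m = n) (e : 'M[S]_m) :
  e *m e = e -> mx_eqv e (castmx (mn, mn) e).
Proof. by case: n / mn => ei; rewrite castmx_id; exists e, e. Qed.

Lemma idmx_sumA e f g :
  idmx_eqv (idmx_sum e (idmx_sum f g)) (idmx_sum (idmx_sum e f) g).
Proof.
have := block_mxAx (imx e) 0 0 0 (imx f) 0 0 0 (imx g).
rewrite /= !row_mx0 !col_mx0 => eqA; apply: idmx_eqv_sym.
rewrite /idmx_eqv /= eqA; apply: mx_eqv_cast.
exact: imxP (idmx_sum (idmx_sum e f) g).
Qed.

Definition idmx0 := @Idmx S 0 0 (mulmx0 _ 0).

Lemma idmx_sum0 e : idmx_eqv (idmx_sum idmx0 e) e.
Proof.
exists (col_mx 0 (imx e)), (row_mx 0 (imx e)).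
rewrite mul_col_row mul_row_col !(mulmx0, mul0mx) imxP add0r.
by split=> //; rewrite /idmx_sum /=.
Qed.


Definition idmx_eqvb e f := `[< idmx_eqv e f >].

Lemma idmx_eqvb_refl : reflexive idmx_eqvb.
Proof. by move=> e; apply/asboolP/idmx_eqv_refl. Qed.

Lemma idmx_eqvb_sym : symmetric idmx_eqvb.
Proof. by move=> e f; apply/asboolP/asboolP; apply: idmx_eqv_sym. Qed.

Lemma idmx_eqvb_trans : transitive idmx_eqvb.
Proof.
by move=> f e g /asboolP ef /asboolP fg; apply/asboolP/(idmx_eqv_trans ef).
Qed.

Canonical idmx_equiv :=
  EquivRel idmx_eqvb idmx_eqvb_refl idmx_eqvb_sym idmx_eqvb_trans.

(** The monoid usually written V(S), of isomorphism classes of finitely generated projectives under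
    direct sum. *)
Definition Vmon := {eq_quot idmx_equiv}.
HB.instance Definition _ := Choice.on Vmon.

Definition Vcl e : Vmon := \pi_Vmon e.

Lemma VclP e f : Vcl e = Vcl f <-> idmx_eqv e f.
Proof. by split=> [/eqmodP/asboolP|ef]; last exact/eqmodP/asboolP. Qed.

Lemma Vcl_surj (v : Vmon) : exists e, v = Vcl e.
Proof. by exists (repr v); rewrite /Vcl reprK. Qed.

Definition Vadd (u v : Vmon) : Vmon := Vcl (idmx_sum (repr u) (repr v)).

Lemma VaddE e f : Vadd (Vcl e) (Vcl f) = Vcl (idmx_sum e f).
Proof. by apply/VclP/idmx_sum_eqv; apply/VclP; rewrite [LHS]reprK. Qed.

Lemma VaddA : associative Vadd.
Proof.
move=> u v w; have [e ->] := Vcl_surj u; have [f ->] := Vcl_surj v.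
have [g ->] := Vcl_surj w; rewrite !VaddE; exact/VclP/idmx_sumA.
Qed.

Lemma VaddC : commutative Vadd.
Proof.
move=> u v; have [e ->] := Vcl_surj u; have [f ->] := Vcl_surj v.
rewrite !VaddE; exact/VclP/idmx_sumC.
Qed.

Lemma Vadd0 : left_id (Vcl idmx0) Vadd.
Proof.
move=> u; have [e ->] := Vcl_surj u.
rewrite VaddE; exact/VclP/idmx_sum0.
Qed.

HB.instance Definition _ := GRing.isNmodule.Build Vmon VaddA VaddC Vadd0.

Lemma VclD e f : Vcl (idmx_sum e f) = Vcl e + Vcl f.
Proof. by rewrite -VaddE. Qed.

End IdempotentMatrices.

Section Refinement.
Variable S : pzRingType.
Hypothesis reg : von_neumann_regular S.

(** The equivalence of [e] with [diag(f, g)] carries the two block projections back to idempotents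
    [m1], [m2]; the blocks of [y x] give their orthogonality and their classes. *)
Lemma Vcl_split n (e : 'M[S]_n) (ei : e *m e = e) (u v : Vmon S) :
  Vcl (Idmx ei) = u + v ->
  exists m1 m2 (i1 : m1 *m m1 = m1) (i2 : m2 *m m2 = m2),
    [/\ orth_idem m1 m2, e = m1 + m2, u = Vcl (Idmx i1) & v = Vcl (Idmx i2)].
Proof.
have [[k f fi] ->] := Vcl_surj u; have [[l g gi] ->] := Vcl_surj v.
rewrite -VclD => /VclP [x [y]] /=.
rewrite -(hsubmxK x) -(vsubmxK y).
move: (lsubmx x) (rsubmx x) (usubmx y) (dsubmx y) => x1 x2 y1 y2 {x y}.
rewrite mul_row_col mul_col_row => -[ee /eq_block_mx [ff fg gf gg]].
pose m1 := x1 *m f *m y1; pose m2 := x2 *m g *m y2.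
have i1 : m1 *m m1 = m1.
  by rewrite /m1 !mulmxA -(mulmxA (x1 *m f)) ff -(mulmxA x1) fi -(mulmxA x1) fi.
have i2 : m2 *m m2 = m2.
  by rewrite /m2 !mulmxA -(mulmxA (x2 *m g)) gg -(mulmxA x2) gi -(mulmxA x2) gi.
exists m1, m2, i1, i2; split.
- split=> //; change (m1 *m m2 = 0) || change (m2 *m m1 = 0).
    by rewrite /m1 /m2 !mulmxA -(mulmxA (x1 *m f)) fg mulmx0 !mul0mx.
  by rewrite /m1 /m2 !mulmxA -(mulmxA (x2 *m g)) gf mulmx0 !mul0mx.
- rewrite -ei -ee mulmxDl !mulmxDr !mulmxA.
  rewrite -(mulmxA x1 y1) ff -(mulmxA x1 y1) fg.
  rewrite -(mulmxA x2 y2) gf -(mulmxA x2 y2) gg.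
  by rewrite !(mulmx0, mul0mx) addr0 add0r.
- apply/VclP; exists (f *m y1), (x1 *m f); split.
    by rewrite /= mulmxA -(mulmxA f) ff fi.
  by rewrite /= mulmxA -(mulmxA x1) fi.
- apply/VclP; exists (g *m y2), (x2 *m g); split.
    by rewrite /= mulmxA -(mulmxA g) gg gi.
  by rewrite /= mulmxA -(mulmxA x2) gi.
Qed.

Lemma Vcl_orth n (e f g : 'M[S]_n) (ei : e *m e = e) (fi : f *m f = f)
    (gi : g *m g = g) :
  orth_idem e f -> g = e + f -> Vcl (Idmx gi) = Vcl (Idmx ei) + Vcl (Idmx fi).
Proof.
case=> _ _ ef fe gE; rewrite -VclD; apply/VclP.
exists (row_mx e f), (col_mx e f); rewrite mul_row_col mul_col_row /= ei fi gE.
by split=> //; congr block_mx.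
Qed.

(** Both decompositions are realised by orthogonal idempotents with the same sum [h] in one matrix
    ring, which is regular, so [ring_refinement] applies there. *)
Lemma V_refinement (a b c d : Vmon S) : a + b = c + d ->
  exists x y z t, [/\ a = x + y, b = z + t, c = x + z & d = y + t].
Proof.
have [[n h hi] abE] := Vcl_surj (a + b); rewrite abE => cdE.
have [p [q [pi [qi [pq hpq -> ->]]]]] := Vcl_split (esym abE).
have [m [l [mi [li [ml hml -> ->]]]]] := Vcl_split cdE.
have regM := matrix_ring_regular (n := n) reg.
have [|p1 [p2 [q1 [q2 [m1 [m2 H]]]]]] := ring_refinement regM pq ml.
  by rewrite -hpq -hml.
case: H => -[op pE] [oq qE] [om mE] [m1p1 m2q1] [opq lpq].
have [p1i p2i _ _] := op; have [q1i q2i _ _] := oq; have [m1i m2i _ _] := om.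
have pqi := orth_idemD opq.
exists (Vcl (Idmx (p1i : p1 *m p1 = p1))), (Vcl (Idmx (p2i : p2 *m p2 = p2))).
exists (Vcl (Idmx (q1i : q1 *m q1 = q1))), (Vcl (Idmx (q2i : q2 *m q2 = q2))).
split.
- exact: Vcl_orth.
- exact: Vcl_orth.
- rewrite (Vcl_orth m1i m2i mi om mE); congr (_ + _).
    by apply/VclP; case: m1p1 => x [y xy]; exists x, y.
  by apply/VclP; case: m2q1 => x [y xy]; exists x, y.
- rewrite -(Vcl_orth p2i q2i pqi opq (erefl _)).
  by apply/VclP; case: lpq => x [y xy]; exists x, y.
Qed.

End Refinement.

(** * Separativity in refinement monoids *)

Section RefinementMonoids.
Variable V : nmodType.
Implicit Types a b c d x y z : V.

Definition refinement := forall a b c d, a + b = c + d ->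
  exists x y z t, [/\ a = x + y, b = z + t, c = x + z & d = y + t].

Definition alg_le a b := exists c, b = a + c.

Lemma alg_le_trans a b c : alg_le a b -> alg_le b c -> alg_le a c.
Proof. by case=> x -> [y ->]; exists (x + y); rewrite addrA. Qed.

Lemma alg_leDl a b : alg_le a (a + b).
Proof. by exists b. Qed.

Lemma alg_leDr a b : alg_le a (b + a).
Proof. by rewrite addrC; exists b. Qed.

Hypothesis refV : refinement.

Lemma alg_le_split c x y : alg_le c (x + y) ->
  exists c1 c2, [/\ c = c1 + c2, alg_le c1 x & alg_le c2 y].
Proof.
case=> d /refV [x1 [x2 [y1 [y2 [-> -> -> _]]]]].
by exists x1, y1; split=> //; apply: alg_leDl.
Qed.

(** [small] will be [cyclic_class], the classes of direct summands of the ring. Closure extension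
    speaks only of ideals, so the cancellation [small_sep] is first obtained there. *)
Variable small : V -> Prop.
Hypothesis smallDl : forall x y, small (x + y) -> small x.
(** Refinement splits [v] along the summands. A first element [x] is singled out so that the
    induction starts from [v] below [x], where [smallDl] applies. *)
Lemma alg_le_small_sum v x (s : seq V) :
  (forall y, y \in x :: s -> small y) -> alg_le v (\sum_(y <- x :: s) y) ->
  exists2 s' : seq V, (forall y, y \in s' -> small y) & v = \sum_(y <- s') y.
Proof.
elim: s => [|x' s IHs] in v x *.
  rewrite big_seq1 => sx [w xE]; exists [:: v]; last by rewrite big_seq1.
  move=> y; rewrite inE => /eqP->; apply: (@smallDl v w).
  by rewrite -xE; apply: sx; rewrite mem_head.
move=> sx; rewrite big_cons => /alg_le_split[v1 [v2 [-> [w xE] v2s]]].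
have [y ys|s' s'P v2E] := IHs v2 x' _ v2s.
  by apply: sx; rewrite inE ys orbT.
exists (v1 :: s'); last by rewrite big_cons v2E.
move=> y; rewrite inE => /predU1P[->|/s'P//]; apply: (@smallDl v1 w).
by rewrite -xE; apply: sx; rewrite mem_head.
Qed.

Hypothesis small_gen : forall v, exists2 s : seq V,
  (forall x, x \in s -> small x) & v = \sum_(x <- s) x.
Hypothesis small_sep : forall a b c, small (a + c) -> a + c = b + c ->
  alg_le c a -> alg_le c b -> a = b.

(** Refinement gives [a = d + a1], [b = d + b1] and [a1 + c1 = c = b1 + c1], which moves the problem
    inside the small element [c]. The parts [u] and [u'] of [c1] that lie under [d] are added to
    both [a1] and [b1]; the rest [v'] of [c1] is then below both, and [small_sep] cancels it. *)
Lemma small_cancel a b c : small c -> a + c = b + c ->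
  alg_le c a -> alg_le c b -> a = b.
Proof.
move=> sc /refV [d [a1 [b1 [c1 [aE cbE bE caE]]]]] ca cb.
have c1c : alg_le c1 c by rewrite caE; apply: alg_leDr.
have : alg_le c1 (d + a1) by rewrite -aE; apply: alg_le_trans ca.
case/alg_le_split=> u [v [c1E [d' dE] va1]].
have : alg_le v (d' + (u + b1)).
  rewrite addrA (addrC d') -dE -bE; apply: alg_le_trans cb.
  by apply: alg_le_trans c1c; rewrite c1E; apply: alg_leDr.
case/alg_le_split=> u' [v' [vE [d'' d'E] v'b1]].
have AC : a1 + (u + u') + v' = c.
  by rewrite caE c1E vE !addrA.
have BC : b1 + (u + u') + v' = c.
  by rewrite cbE c1E vE !addrA.
have AB : a1 + (u + u') = b1 + (u + u').
  apply: (small_sep (c := v')); rewrite ?AC ?BC //.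
    apply: alg_le_trans (alg_leDl _ _).
    by apply: alg_le_trans va1; rewrite vE; apply: alg_leDr.
  by apply: alg_le_trans v'b1 _; rewrite addrA (addrC b1); apply: alg_leDl.
have split_d x : d + x = d'' + (x + (u + u')).
  by rewrite dE d'E !addrA [RHS](ACl (3*4*1*2)).
by rewrite aE bE !split_d AB.
Qed.

Lemma small_sum_cancel a b (s : seq V) :
  (forall x, x \in s -> [/\ small x, alg_le x a & alg_le x b]) ->
  a + \sum_(x <- s) x = b + \sum_(x <- s) x -> a = b.
Proof.
elim: s => [|x s IHs] sP; first by rewrite big_nil !addr0.
rewrite big_cons !(addrCA _ x) ![x + _]addrC => eqx.
have [sx xa xb] := sP x (mem_head _ _).
apply: IHs => [y ys|]; first by apply: sP; rewrite inE ys orbT.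
apply: small_cancel sx eqx _ _.
  exact: alg_le_trans xa (alg_leDl _ _).
exact: alg_le_trans xb (alg_leDl _ _).
Qed.

Lemma small_decomp_le a b c (s : seq V) :
  (forall x, x \in s -> [/\ small x, alg_le x a & alg_le x (b + c)]) ->
  exists2 s' : seq V, \sum_(x <- s) x = \sum_(x <- s') x
    & forall x, x \in s' ->
      [/\ small x, alg_le x a & alg_le x b \/ alg_le x c].
Proof.
elim: s => [|x s IHs] sP; first by exists [::].
have [y ys|s' s'E s'P] := IHs; first by apply: sP; rewrite inE ys orbT.
have [sx xa xb] := sP x (mem_head _ _).
have [u [v [xE ub vc]]] := alg_le_split xb.
exists [:: u, v & s']; first by rewrite !big_cons s'E xE addrA.
have ux : alg_le u x by rewrite xE; apply: alg_leDl.
have vx : alg_le v x by rewrite xE; apply: alg_leDr.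
have su : small u by apply: (@smallDl u v); rewrite -xE.
have sv : small v by apply: (@smallDl v u); rewrite addrC -xE.
move=> y; rewrite !inE => /or3P[/eqP->|/eqP->|/s'P //].
  by split=> //; [apply: alg_le_trans xa|left].
by split=> //; [apply: alg_le_trans xa|right].
Qed.

(** Write [a] as a sum of small elements. Each is below [a + b = b + b], hence splits into pieces
    below [b]; in [a + a = b + a] the right-hand summand [a] is cancelled piece by piece. *)
Lemma refinement_separative a b : a + a = a + b -> a + b = b + b -> a = b.
Proof.
move=> aab abb.
have [s sP aE] := small_gen a.
have [x xs|s' s'E s'P] := @small_decomp_le a b b s.
  have xa : alg_le x a by rewrite aE (big_rem x) //=; apply: alg_leDl.
  split=> //; first exact: sP.
  by rewrite -abb; apply: alg_le_trans xa (alg_leDl _ _).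
apply: (@small_sum_cancel a b s') => [x /s'P[sx xa xb]|].
  by split=> //; case: xb.
by rewrite -s'E -aE aab addrC.
Qed.

End RefinementMonoids.

(** * Isomorphism of essential submodules *)

Section EssentialEquivalence.
Variable S : pzRingType.
Implicit Types U V W : lmodType S.

Definition submodule U (A : set U) :=
  [/\ A 0, forall x y, A x -> A y -> A (x + y) & forall r x, A x -> A (r *: x)].

Definition essential U (I A : set U) :=
  forall x, A x -> x != 0 -> exists r, r *: x != 0 /\ I (r *: x).

(** A partial isomorphism, encoded as a submodule of [U * V] that meets both factors trivially:
    domain and range are its projections, and inversion and composition are those of relations. *)
Definition iso_graph U V (G : U -> V -> Prop) :=
  [/\ G 0 0, forall x y x' y', G x y -> G x' y' -> G (x + x') (y + y'),
      forall r x y, G x y -> G (r *: x) (r *: y),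
      forall x, G x 0 -> x = 0 & forall y, G 0 y -> y = 0].

(* Equivalently, the injective hulls of [A] and [B] are isomorphic. *)
Definition ess_iso U V (A : set U) (B : set V) :=
  exists G, [/\ iso_graph G, forall x y, G x y -> A x /\ B y,
    essential [set x | exists y, G x y] A
    & essential [set y | exists x, G x y] B].

Lemma submoduleN U (A : set U) x : submodule A -> A x -> A (- x).
Proof. by case=> _ _ AZ Ax; rewrite -scaleN1r; apply: AZ. Qed.

Lemma essential_total U (I A : set U) : (forall x, A x -> I x) -> essential I A.
Proof.
by move=> AI x Ax x0; exists 1; rewrite scale1r; split=> //; apply: AI.
Qed.

Lemma ess_iso_graph U V (A : set U) (B : set V) (G : U -> V -> Prop) :
  iso_graph G -> (forall x y, G x y -> A x /\ B y) ->
  (forall x, A x -> exists y, G x y) -> (forall y, B y -> exists x, G x y) ->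
  ess_iso A B.
Proof.
by move=> Gi GAB GA GB; exists G; split=> //; apply: essential_total.
Qed.

Lemma ess_iso_sym U V (A : set U) (B : set V) : ess_iso A B -> ess_iso B A.
Proof.
case=> G [[G0 GD GZ Gl Gr] GAB GA GB]; exists (fun y x => G x y).
split=> //; last by move=> y x /GAB[].
by split=> // *; [apply: GD|apply: GZ].
Qed.

Lemma iso_graph0 U V (G : U -> V -> Prop) x y :
  iso_graph G -> G x y -> (x != 0) = (y != 0).
Proof.
case=> _ _ _ Gl Gr Gxy; congr (~~ _); apply/eqP/eqP => xy0.
  by apply: Gr; rewrite -xy0.
by apply: Gl; rewrite -xy0.
Qed.

(** The domain of the composite is still essential: one multiple brings [x] into the domain of [G],
    and a second one brings its image into the domain of [H]. *)
Lemma ess_iso_trans U V W (A : set U) (B : set V) (C : set W) :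
  ess_iso A B -> ess_iso B C -> ess_iso A C.
Proof.
case=> G [Gi GAB GA GB] [H [Hi HBC HB HC]].
have [G0 GD GZ Gl Gr] := Gi; have [H0 HD HZ Hl Hr] := Hi.
exists (fun x z => exists2 y, G x y & H y z); split.
- split; first by exists 0.
  + move=> x z x' z' [y xy yz] [y' xy' yz'].
    by exists (y + y'); [apply: GD|apply: HD].
  + by move=> r x z [y xy yz]; exists (r *: y); [apply: GZ|apply: HZ].
  + by move=> x [y xy /Hl y0]; apply: Gl; rewrite -y0.
  + by move=> z [y /Gr -> /Hr].
- by move=> x z [y /GAB[? _] /HBC[]].
- move=> x Ax x0; have [r [rx0 [y rxy]]] := GA _ Ax x0.
  have [_ By] := GAB _ _ rxy; rewrite (iso_graph0 Gi rxy) in rx0.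
  have [s [sy0 [z syz]]] := HB _ By rx0; exists (s * r).
  have sry : G ((s * r) *: x) (s *: y) by rewrite -scalerA; apply: GZ.
  by rewrite (iso_graph0 Gi sry); split=> //; exists z, (s *: y).
- move=> z Cz z0; have [r [rz0 [y ryz]]] := HC _ Cz z0.
  have [By _] := HBC _ _ ryz; rewrite -(iso_graph0 Hi ryz) in rz0.
  have [s [sy0 [x sxy]]] := GB _ By rz0; exists (s * r).
  have srz : H (s *: y) ((s * r) *: z) by rewrite -scalerA; apply: HZ.
  by rewrite -(iso_graph0 Hi srz); split=> //; exists x, (s *: y).
Qed.

Lemma ess_iso_refl U (A : set U) : submodule A -> ess_iso A A.
Proof.
case=> A0 AD AZ; apply: (@ess_iso_graph _ _ _ _ (fun x y => A x /\ y = x)).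
- split=> //; try by move=> ? [].
  + by move=> x _ x' _ [Ax ->] [Ax' ->]; split=> //; apply: AD.
  + by move=> r x _ [Ax ->]; split=> //; apply: AZ.
- by move=> x _ [? ->].
- by move=> x Ax; exists x.
- by move=> x Ax; exists x.
Qed.

Definition prodset U V (A : set U) (B : set V) : set (U * V)%type :=
  [set w | A w.1 /\ B w.2].

Lemma submodule_prod U V (A : set U) (B : set V) :
  submodule A -> submodule B -> submodule (prodset A B).
Proof.
case=> A0 AD AZ [B0 BD BZ]; split=> //.
  by move=> x y [? ?] [? ?]; split; [apply: AD|apply: BD].
by move=> r x [? ?]; split; [apply: AZ|apply: BZ].
Qed.

Lemma essential_prod U V (I A : set U) (J B : set V) :
  submodule A -> submodule B -> submodule I -> submodule J ->
  essential I A -> essential J B -> essential (prodset I J) (prodset A B).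
Proof.
move=> [_ _ AZ] [_ _ BZ] [I0 _ IZ] [J0 _ JZ] IA JB [x y] [/= Ax By].
rewrite xpair_eqE negb_and => xy0.
(* The components are treated in turn; a further multiple [s] is taken only when [r *: y] is
   nonzero, and then [s *: (r *: y)] keeps the pair nonzero. *)
have [r [rxy0 Irx]] : exists r, r *: (x, y) != 0 :> U * V /\ I (r *: x).
  have [x0|x0] := eqVneq x 0.
    by exists 1; rewrite !scale1r xpair_eqE negb_and x0 -{1}x0.
  have [r [rx0 Irx]] := IA x Ax x0.
  by exists r; rewrite xpair_eqE negb_and /= rx0.
have [ry0|ry0] := eqVneq (r *: y) 0.
  by exists r; split=> //; split=> //=; rewrite ry0.
have [s [sy0 Jsy]] := JB _ (BZ _ _ By) ry0.
exists (s * r); rewrite xpair_eqE negb_and /= -!scalerA sy0 orbT; split=> //.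
by split=> //=; apply: IZ.
Qed.

Lemma iso_graph_dom U V (G : U -> V -> Prop) :
  iso_graph G -> submodule [set x | exists y, G x y].
Proof.
case=> G0 GD GZ _ _; split; first by exists 0.
  by move=> x x' [y xy] [y' xy']; exists (y + y'); apply: GD.
by move=> r x [y xy]; exists (r *: y); apply: GZ.
Qed.

Lemma iso_graph_ran U V (G : U -> V -> Prop) :
  iso_graph G -> submodule [set y | exists x, G x y].
Proof.
case=> G0 GD GZ _ _; split; first by exists 0.
  by move=> y y' [x xy] [x' xy']; exists (x + x'); apply: GD.
by move=> r y [x xy]; exists (r *: x); apply: GZ.
Qed.

Lemma essentialW U (I J A : set U) :
  I `<=` J -> essential I A -> essential J A.
Proof.
move=> IJ IA x Ax x0; have [r [? ?]] := IA x Ax x0.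
by exists r; split=> //; apply: IJ.
Qed.

Lemma ess_iso_prod U V U' V'
    (A : set U) (B : set V) (A' : set U') (B' : set V') :
  submodule A -> submodule B -> submodule A' -> submodule B' ->
  ess_iso A A' -> ess_iso B B' -> ess_iso (prodset A B) (prodset A' B').
Proof.
move=> sA sB sA' sB' [G [Gi GAB GA GB]] [H [Hi HAB HA HB]].
have [G0 GD GZ Gl Gr] := Gi; have [H0 HD HZ Hl Hr] := Hi.
exists (fun w w' => G w.1 w'.1 /\ H w.2 w'.2); split.
- split=> //.
  + by move=> x y x' y' [? ?] [? ?]; split; [apply: GD|apply: HD].
  + by move=> r x y [? ?]; split; [apply: GZ|apply: HZ].
  + by move=> [x y] [/= /Gl-> /Hl->].
  + by move=> [x y] [/= /Gr-> /Hr->].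
- by move=> [x y] [x' y'] [/= /GAB[? ?] /HAB[? ?]].
- apply: essentialW (essential_prod sA sB _ _ GA HA);
    [|exact: iso_graph_dom Gi|exact: iso_graph_dom Hi].
  by move=> [x y] [/= [x' xx'] [y' yy']]; exists (x', y').
- apply: essentialW (essential_prod sA' sB' _ _ GB HB);
    [|exact: iso_graph_ran Gi|exact: iso_graph_ran Hi].
  by move=> [x y] [/= [x' xx'] [y' yy']]; exists (x', y').
Qed.

Lemma ess_iso_prodC U V (A : set U) (B : set V) :
  submodule A -> submodule B -> ess_iso (prodset A B) (prodset B A).
Proof.
move=> sA sB; have [AB0 ABD ABZ] := submodule_prod sA sB.
apply: (@ess_iso_graph _ _ _ _ (fun w w' => prodset A B w /\ w' = (w.2, w.1))).
- split=> //.
  + by move=> x _ x' _ [Ax ->] [Ax' ->]; split=> //; apply: ABD.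
  + by move=> r x _ [Ax ->]; split=> //; apply: ABZ.
  + by move=> [x y] [_ [<- <-]].
  + by move=> _ [_ ->].
- by move=> [x y] _ [[? ?] ->].
- by move=> w Aw; exists (w.2, w.1).
- by move=> [x y] [/= ? ?]; exists (y, x).
Qed.

Lemma ess_iso_prodA U V W (A : set U) (B : set V) (C : set W) :
  submodule A -> submodule B -> submodule C ->
  ess_iso (prodset A (prodset B C)) (prodset (prodset A B) C).
Proof.
move=> sA sB sC.
have [ABC0 ABCD ABCZ] := submodule_prod sA (submodule_prod sB sC).
apply: (@ess_iso_graph _ _ _ _ (fun w w' =>
  prodset A (prodset B C) w /\ w' = ((w.1, w.2.1), w.2.2))).
- split=> //.
  + by move=> x _ x' _ [Ax ->] [Ax' ->]; split=> //; apply: ABCD.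
  + by move=> r x _ [Ax ->]; split=> //; apply: ABCZ.
  + by move=> [x [y z]] [_ [<- <- <-]].
  + by move=> _ [_ ->].
- by move=> [x [y z]] _ [[? [? ?]] ->].
- by move=> w Aw; exists ((w.1, w.2.1), w.2.2).
- by move=> [[x y] z] [[/= ? ?] ?]; exists (x, (y, z)).
Qed.

Lemma ess_iso_direct_sum U (A I J : set U) :
  submodule A -> submodule I -> submodule J -> I `<=` A -> J `<=` A ->
  (forall x, I x -> J x -> x = 0) ->
  essential [set x | exists y z, [/\ I y, J z & x = y + z]] A ->
  ess_iso A (prodset I J).
Proof.
move=> [A0 AD _] sI sJ IA JA IJ0 IJA.
have [IJ00 IJD IJZ] := submodule_prod sI sJ.
exists (fun x w => prodset I J w /\ x = w.1 + w.2); split.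
- split=> //.
  + by split=> //; rewrite addr0.
  + by move=> _ y _ y' [? ->] [? ->]; rewrite addrACA; split=> //; apply: IJD.
  + by move=> r _ y [? ->]; rewrite scalerDr; split=> //; apply: IJZ.
  + by move=> x [_ ->]; rewrite addr0.
  + move=> [y z] [[/= Iy Jz]] /esym/eqP; rewrite addr_eq0 => /eqP yz.
    have y0 : y = 0 by apply: IJ0 => //; rewrite yz; apply: submoduleN.
    by move: yz; rewrite y0 => /esym/eqP; rewrite oppr_eq0 => /eqP ->.
- by move=> x [y z] [[/= Iy Jz] ->]; split=> //; apply: AD; [apply: IA|apply: JA].
- apply: essentialW IJA => _ [y [z [Iy Jz ->]]].
  by exists (y, z).
- by apply: essential_total => -[y z] IJw; exists (y + z).
Qed.

Lemma complement_exists U (A I : set U) : submodule A -> submodule I ->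
  exists W : set U, [/\ submodule W, W `<=` A, forall x, W x -> I x -> x = 0
    & essential [set x | exists y z, [/\ W y, I z & x = y + z]] A].
Proof.
move=> sA sI; have [A0 AD AZ] := sA; have [I0 ID IZ] := sI.
(* [W 0] is left out of [P] because the union of the empty chain is empty; maximality restores it
   below, an empty [W] being properly contained in [[set 0]]. *)
pose P (W : set U) := [/\ forall x y, W x -> W y -> W (x + y),
  forall r x, W x -> W (r *: x), W `<=` A & forall x, W x -> I x -> x = 0].
have [F FP Ftot|W [PW Wmax]] := @Zorn_bigcup U P.
  split.
  - move=> x y [X FX Xx] [Y FY Yy].
    have [XY|YX] := Ftot _ _ FX FY.
      by exists Y => //; have [YD _ _ _] := FP _ FY; apply: YD => //; apply: XY.
    by exists X => //; have [XD _ _ _] := FP _ FX; apply: XD => //; apply: YX.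
  - by move=> r x [X FX Xx]; exists X => //; have [_ XZ _ _] := FP _ FX; apply: XZ.
  - by move=> x [X FX Xx]; have [_ _ XA _] := FP _ FX; apply: XA.
  - by move=> x [X FX Xx]; have [_ _ _ XI] := FP _ FX; apply: XI.
have [WD WZ WA WI] := PW.
have W0 : W 0.
  apply: contrapT => nW0; apply: (Wmax [set 0]).
    split=> [x Wx|/(_ 0 erefl)//].
    by case: nW0; rewrite -(scale0r x); apply: WZ.
  split=> [x y -> ->|r x ->|x ->|x -> //]; rewrite ?addr0 ?scaler0 //.
exists W; split=> // x Ax x0; apply: contrapT => nx.
have {}nx r w i : W w -> I i -> r *: x = w + i -> r *: x = 0.
  move=> Ww Ii rx; apply: contrapT => /eqP rx0; apply: nx; exists r.
  by split=> //; exists w, i.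
have Wx : ~ W x.
  move=> Wx; case/eqP: x0; rewrite -(scale1r x).
  by apply: (nx _ x 0) => //; rewrite scale1r addr0.
(* As no nonzero multiple of [x] lies in [W + I], the larger submodule [W + S x] still meets [I]
   trivially, against maximality. *)
pose X : set U := [set v | exists w r, W w /\ v = w + r *: x].
apply: (Wmax X).
  split=> [w Ww|XW]; first by exists w, 0; rewrite scale0r addr0.
  by apply/Wx/XW; exists 0, 1; rewrite scale1r add0r.
split.
- move=> _ _ [w [r [Ww ->]]] [w' [r' [Ww' ->]]]; exists (w + w'), (r + r').
  by rewrite scalerDl addrACA; split=> //; apply: WD.
- move=> s _ [w [r [Ww ->]]]; exists (s *: w), (s * r).
  by rewrite scalerDr scalerA; split=> //; apply: WZ.
- by move=> _ [w [r [Ww ->]]]; apply: AD; [apply: WA|apply: AZ].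
- move=> _ [w [r [Ww ->]]] Iv.
  have rx0 : r *: x = 0.
    apply: nx (_ : W (- w)) Iv _; last by rewrite addKr.
    by rewrite -scaleN1r; apply: WZ.
  by move: Iv; rewrite rx0 addr0; apply: WI.
Qed.

End EssentialEquivalence.

(** * Absorption of a module embedded infinitely often *)

Section Absorption.
Variables (S : pzRingType) (U V : lmodType S) (Z : set U) (B : set V).
Variable k : nat -> {linear U -> V}.
Hypotheses (sZ : submodule Z) (sB : submodule B).
Hypothesis kB : forall i x, Z x -> B (k i x).
Hypothesis k_indep : forall n (x : nat -> U), (forall i, Z (x i)) ->
  \sum_(i < n) k i (x i) = 0 -> forall i, (i < n)%N -> x i = 0.

Let finfam n (x : nat -> U) :=
  (forall i, Z (x i)) /\ forall i, (n <= i)%N -> x i = 0.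

Let finfamW n m x : (n <= m)%N -> finfam n x -> finfam m x.
Proof. by move=> nm [xZ x0]; split=> // i mi; apply: x0 (leq_trans nm mi). Qed.

Let sum_widen n m x : (n <= m)%N -> finfam n x ->
  \sum_(i < m) k i (x i) = \sum_(i < n) k i (x i).
Proof.
move=> /subnKC <- [_ x0]; elim: (m - n)%N => [|d IHd]; first by rewrite addn0.
by rewrite addnS big_ord_recr /= IHd x0 ?leq_addr // linear0 addr0.
Qed.

Let finfamD n x y : finfam n x -> finfam n y -> finfam n (fun i => x i + y i).
Proof.
have [_ ZD _] := sZ; move=> [xZ x0] [yZ y0].
by split=> [i|i ni]; [apply: ZD|rewrite x0 // y0 // addr0].
Qed.

Let finfamZ n r x : finfam n x -> finfam n (fun i => r *: x i).
Proof.
have [_ _ ZZ] := sZ; move=> [xZ x0].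
by split=> [i|i ni]; [apply: ZZ|rewrite x0 // scaler0].
Qed.

Let finfam_shift n x : finfam n.+1 x -> finfam n (fun i => x i.+1).
Proof. by case=> xZ x0; split=> // i ni; apply: x0. Qed.

Let sumD n x y :
  \sum_(i < n) k i (x i + y i)
  = \sum_(i < n) k i (x i) + \sum_(i < n) k i (y i).
Proof. by rewrite -big_split; apply: eq_bigr => i _; rewrite linearD. Qed.

Let sumZ n r x : \sum_(i < n) k i (r *: x i) = r *: \sum_(i < n) k i (x i).
Proof. by rewrite scaler_sumr; apply: eq_bigr => i _; rewrite linearZ. Qed.

Let K : set V := [set v | exists n x, finfam n x /\ v = \sum_(i < n) k i (x i)].

Let finfam0 n : finfam n (fun=> 0).
Proof. by split=> // i; case: sZ. Qed.

Let sum0 n : \sum_(i < n) k i 0 = 0.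
Proof. by apply: big1 => i _; rewrite linear0. Qed.

Let sK : submodule K.
Proof.
split.
- by exists 0%N, (fun=> 0); rewrite big_ord0; split=> //; apply: finfam0.
- move=> _ _ [n [x [xf ->]]] [m [y [yf ->]]].
  exists (maxn n m), (fun i => x i + y i); split.
    by apply: finfamD; [apply: finfamW xf|apply: finfamW yf];
      rewrite ?leq_maxl ?leq_maxr.
  by rewrite sumD (sum_widen (leq_maxl n m) xf) (sum_widen (leq_maxr n m) yf).
- move=> r _ [n [x [xf ->]]]; exists n, (fun i => r *: x i).
  by rewrite sumZ; split=> //; apply: finfamZ.
Qed.

Let KB : K `<=` B.
Proof.
move=> _ [n [x [[xZ _] ->]]]; have [B0 BD _] := sB.
by apply: big_ind => // i _; apply: kB.
Qed.

(* Hilbert's hotel: [(sum_i k_i x_(i+1), x_0)] goes to [sum_i k_i x_i]. *)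
Let ess_iso_shift : ess_iso (prodset K Z) K.
Proof.
pose G (w : V * U) (v : V) := exists n x, [/\ finfam n.+1 x, w.2 = x 0%N,
  w.1 = \sum_(i < n) k i (x i.+1) & v = \sum_(i < n.+1) k i (x i)].
apply: (@ess_iso_graph _ _ _ _ _ G).
- split.
  + exists 0%N, (fun=> 0); split; rewrite ?sum0 //.
  + move=> [v z] v' [w t] w' [n [x [xf /= -> -> ->]]] [m [y [yf /= -> -> ->]]].
    have nN := leq_maxl n m; have mN := leq_maxr n m.
    exists (maxn n m), (fun i => x i + y i); split=> //=.
    * by apply: finfamD; [apply: finfamW xf|apply: finfamW yf].
    * rewrite (@sumD _ (fun i => x i.+1) (fun i => y i.+1)).
      congr (_ + _); apply/esym.
        exact: sum_widen nN (finfam_shift xf).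
      exact: sum_widen mN (finfam_shift yf).
    * rewrite sumD; congr (_ + _); apply/esym.
        exact: sum_widen xf.
      exact: sum_widen yf.
  + move=> r [v z] v' [n [x [xf /= -> -> ->]]].
    exists n, (fun i => r *: x i); split=> //=; first exact: finfamZ.
      by rewrite (@sumZ _ r (fun i => x i.+1)).
    by rewrite sumZ.
  + move=> [v z] [n [x [[xZ x0] /= -> -> /esym/k_indep xn]]].
    have {}xn i : x i = 0 by case: (ltnP i n.+1) => ni; [apply: xn|apply: x0].
    by rewrite big1 ?xn // => i _; rewrite xn linear0.
  + move=> v [n [x [[xZ x0] /= /esym x00 /esym vE ->]]].
    have xn := k_indep (x := fun i => x i.+1) (fun i => xZ i.+1) vE.
    apply: big1 => -[[|i] /= ni] _; first by rewrite x00 linear0.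
    by rewrite xn ?linear0.
- move=> [v z] v' [n [x [xf /= -> -> ->]]]; split; last by exists n.+1, x.
  split=> /=; last by case: xf.
  by exists n, (fun i => x i.+1); split=> //; apply: finfam_shift.
- move=> [v z] [/= [n [x [[xZ x0] ->]]] Zz].
  pose y i := if i is j.+1 then x j else z.
  exists (\sum_(i < n.+1) k i (y i)), n, y; split=> //=.
  by split=> -[|i] //= ni; apply: x0.
- move=> v [n [x [xf ->]]].
  exists (\sum_(i < n) k i (x i.+1), x 0%N), n, x; split=> //.
    exact: finfamW xf.
  by rewrite (sum_widen (leqnSn n) xf).
Qed.

(** With [K] the sum of the copies of [Z] and [W] a complement of [K] in [B], only [K] needs to
    absorb [Z]: [B ~ W + K ~ W + (K + Z) ~ B + Z]. *)
Lemma ess_iso_absorb : ess_iso B (prodset B Z).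
Proof.
have [W [sW WB WK WKB]] := complement_exists sB sK.
have BWK : ess_iso B (prodset W K) by apply: ess_iso_direct_sum.
have sWK := submodule_prod sW sK; have sKZ := submodule_prod sK sZ.
apply: (ess_iso_trans BWK).
apply: (@ess_iso_trans _ _ _ _ _ (prodset W (prodset K Z))).
  apply: ess_iso_prod => //; first exact: ess_iso_refl.
  exact/ess_iso_sym/ess_iso_shift.
apply: ess_iso_trans (ess_iso_prodA sW sK sZ) _.
apply: ess_iso_prod => //; last exact: ess_iso_refl.
exact: ess_iso_sym BWK.
Qed.

End Absorption.

(** * Decreasing chains of idempotents *)

Section Chains.
Variable S : pzRingType.
Implicit Types a b d e f p u v : S.

(** Trimming [x] by [f] and [y] by [e] keeps both products. Right multiplications by the new [x] and
    [y] are then inverse isomorphisms between [S e] and [S f]. *)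
Lemma ring_eqv_normal e f : e * e = e -> f * f = f -> ring_eqv e f ->
  exists x y, [/\ x * y = e, y * x = f, x * f = x & y * e = y].
Proof.
move=> ee ff [x [y [xy yx]]]; exists (x * f), (y * e).
rewrite -!mulrA ee ff; split=> //.
  by rewrite (mulrA f) -yx -(mulrA y) xy -mulrA ee (mulrA x) xy ee.
by rewrite (mulrA e) -xy -(mulrA x) yx -mulrA ff (mulrA y) yx ff.
Qed.

Let scaleE (r : S) (x : S^o) : r *: x = (r * x : S). Proof. by []. Qed.

(** For idempotent [a], this is the left ideal [S a]. *)
Definition left_ideal a : set S^o := [set x : S | x * a = x].

Lemma submodule_left_ideal a : submodule (left_ideal a).
Proof.
split; first exact: mul0r.
  by move=> x y xa ya; rewrite /left_ideal /= mulrDl xa ya.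
by move=> r x xa; rewrite /left_ideal /= scaleE -mulrA xa.
Qed.

Definition chain (a_ d_ : nat -> S) :=
  forall n, orth_idem (d_ n) (a_ n.+1) /\ a_ n = d_ n + a_ n.+1.

Section ChainTheory.
Variables (a_ d_ : nat -> S).
Hypothesis ch : chain a_ d_.

Lemma chain_idem n : a_ n * a_ n = a_ n.
Proof. by have [o ->] := ch n; apply: orth_idemD. Qed.

Lemma chain_le i j : (i <= j)%N -> a_ i * a_ j = a_ j /\ a_ j * a_ i = a_ j.
Proof.
move=> /subnKC <-; elim: (j - i)%N => [|k [IH1 IH2]].
  by rewrite addn0 chain_idem.
have [[dd aa da ad] aE] := ch (i + k).
have ak : a_ (i + k) * a_ (i + k.+1) = a_ (i + k.+1).
  by rewrite addnS aE mulrDl aa da add0r.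
have ka : a_ (i + k.+1) * a_ (i + k) = a_ (i + k.+1).
  by rewrite addnS aE mulrDr aa ad add0r.
by split; [rewrite -ak mulrA IH1|rewrite -ka -mulrA IH2].
Qed.

Lemma chain_idem_d n : d_ n * d_ n = d_ n.
Proof. by have [[]] := ch n. Qed.

Lemma chain_da i : d_ i * a_ i = d_ i /\ a_ i * d_ i = d_ i.
Proof.
by have [[dd aa da ad] ->] := ch i; rewrite mulrDr mulrDl dd da ad addr0.
Qed.

Lemma chain_da_ge i j : (j <= i)%N -> d_ i * a_ j = d_ i /\ a_ j * d_ i = d_ i.
Proof.
move=> ji; have [da ad] := chain_da i; have [aij aji] := chain_le ji.
by split; [rewrite -da -mulrA aji|rewrite -ad mulrA aij].
Qed.

Lemma chain_da_lt i j : (i < j)%N -> d_ i * a_ j = 0 /\ a_ j * d_ i = 0.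
Proof.
move=> ij; have [[_ _ da ad] _] := ch i; have [aij aji] := chain_le ij.
by split; [rewrite -aij mulrA da mul0r|rewrite -aji -mulrA ad mulr0].
Qed.

Lemma chain_dd i j : i != j -> d_ i * d_ j = 0.
Proof.
case: ltngtP => // ij _.
  by rewrite -(chain_da j).2 mulrA (chain_da_lt ij).1 mul0r.
by rewrite -(chain_da i).1 -mulrA (chain_da_lt ij).2 mulr0.
Qed.

Lemma chain_eq0 x : (forall i, x * d_ i = 0) ->
  x * a_ 0 = x -> (exists n, x * a_ n = 0) -> x = 0.
Proof.
move=> xd xa [n xn]; rewrite -xa; suff -> : x * a_ 0 = x * a_ n by [].
by elim: (n) => // m ->; have [_ ->] := ch m; rewrite mulrDr xd add0r.
Qed.

(* The direct sum of the left ideals [S d_n]. *)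
Definition chain_sum : set S^o :=
  [set x : S | x * a_ 0 = x /\ exists n, x * a_ n = 0].

Lemma chain_sum0 n (x : S) : x * a_ n = 0 ->
  forall m, (n <= m)%N -> x * a_ m = 0.
Proof. by move=> xn m nm; rewrite -(chain_le nm).1 mulrA xn mul0r. Qed.

Lemma submodule_chain_sum : submodule chain_sum.
Proof.
split; first by split; [exact: mul0r|exists 0%N; exact: mul0r].
- move=> x y [xa [n xn]] [ya [m ym]]; split; first by rewrite mulrDl xa ya.
  exists (maxn n m); rewrite mulrDl (chain_sum0 xn) ?leq_maxl //.
  by rewrite (chain_sum0 ym) ?leq_maxr // addr0.
- move=> r x [xa [n xn]]; split; first by rewrite scaleE -mulrA xa.
  by exists n; rewrite scaleE -mulrA xn mulr0.
Qed.

End ChainTheory.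

(** If [x a_n = 0], only the components [x d_i] with [i < n] can be nonzero. Right multiplication by
    [u i] sends the [i]-th one to [S e_i], and [y] is the finite sum of these images. *)
Lemma chain_sum_transfer (a_ d_ b_ e_ : nat -> S) (u v : nat -> S) :
  chain a_ d_ -> chain b_ e_ ->
  (forall i, [/\ u i * v i = d_ i, v i * u i = e_ i, u i * e_ i = u i
    & v i * d_ i = v i]) ->
  forall x, chain_sum a_ x ->
  exists2 y, chain_sum b_ y & forall i, x * u i = y * e_ i.
Proof.
move=> ca cb uv x [xa [n xn]]; exists (\sum_(i < n) x * u i).
  split.
    rewrite mulr_suml; apply: eq_bigr => i _; have [_ _ ue _] := uv i.
    by rewrite -ue -!mulrA (chain_da_ge cb (leq0n i)).1.
  exists n; rewrite mulr_suml; apply: big1 => i _; have [_ _ ue _] := uv i.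
  by rewrite -ue -!mulrA (chain_da_lt cb (ltn_ord i)).1 !mulr0.
move=> j; rewrite mulr_suml; have [uvj vuj uej _] := uv j.
have ue i : i != j -> u i * e_ j = 0.
  by move=> ij; have [_ _ <- _] := uv i; rewrite -mulrA (chain_dd cb ij) mulr0.
have [jn|nj] := ltnP j n.
  rewrite (bigD1 (Ordinal jn)) //= -mulrA uej big1 ?addr0 // => i ij.
  by rewrite -mulrA ue ?mulr0.
rewrite big1 => [|i _].
  have du : d_ j * u j = u j by rewrite -uvj -mulrA vuj.
  have xd : x * d_ j = 0 by rewrite -(chain_da_ge ca nj).2 mulrA xn mul0r.
  by rewrite -du mulrA xd mul0r.
by rewrite -mulrA ue ?mulr0 // neq_ltn (leq_trans (ltn_ord i) nj).
Qed.

Lemma ess_iso_chain_sum (a_ d_ b_ e_ : nat -> S) : chain a_ d_ -> chain b_ e_ ->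
  (forall i, ring_eqv (d_ i) (e_ i)) -> ess_iso (chain_sum a_) (chain_sum b_).
Proof.
move=> ca cb de.
have [u uP] := choice (fun i =>
  ring_eqv_normal (chain_idem_d ca i) (chain_idem_d cb i) (de i)).
have [v uv] := choice uP.
have vu i : [/\ v i * u i = e_ i, u i * v i = d_ i, v i * d_ i = v i
    & u i * e_ i = u i] by have [] := uv i.
have [a0 aD aZ] := submodule_chain_sum ca.
have [b0 bD bZ] := submodule_chain_sum cb.
apply: (@ess_iso_graph _ _ _ _ _ (fun x y : S^o =>
  [/\ chain_sum a_ x, chain_sum b_ y
    & forall i, (x : S) * u i = (y : S) * e_ i])).
- split.
  + by split=> // i; rewrite !mul0r.
  + move=> x y x' y' [Ax By xy] [Ax' By' xy']; split; [exact: aD|exact: bD|].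
    by move=> i; rewrite !mulrDl xy xy'.
  + move=> r x y [Ax By xy]; split; [exact: aZ|exact: bZ|].
    by move=> i; rewrite !scaleE -!mulrA xy.
  + move=> x [[xa xn] _ xu]; apply: (chain_eq0 ca) => // i.
    by have [<- _ _ _] := uv i; rewrite mulrA xu mul0r mul0r.
  + move=> y [_ [ya yn] yu]; apply: (chain_eq0 cb) => // i.
    by rewrite -yu mul0r.
- by move=> x y [].
- by move=> x Ax; have [y By xy] := chain_sum_transfer ca cb uv Ax; exists y.
- move=> y By; have [x Ax xy] := chain_sum_transfer cb ca vu By; exists x.
  split=> // i; have [uvi vui _ _] := uv i.
  have du : d_ i * u i = u i.
    by have [_ _ ue _] := uv i; rewrite -uvi -mulrA vui.
  by rewrite -du mulrA -xy -mulrA vui.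
Qed.

Definition rmul (w : S) : S^o -> S^o := fun x => (x : S) * w.

Fact rmul_linear w : linear (rmul w).
Proof. by move=> r x y; rewrite /rmul mulrDl !scaleE mulrA. Qed.

HB.instance Definition _ w :=
  GRing.isLinear.Build S S^o S^o *:%R (rmul w) (rmul_linear w).

(** Right multiplication by [a_(n+1)] is injective on [Z], so [Z] embeds in [S a_(n+1)], hence in
    its copy [S p_n]. The [p_n] are orthogonal and lie under [c_0], so these embeddings into [S b]
    are independent. *)
Lemma ess_iso_absorb_chain (a_ d_ c_ p_ : nat -> S) b (Z : set S^o) :
  chain a_ d_ -> chain c_ p_ -> submodule Z ->
  (forall (x : S^o) n, Z x -> (x : S) * a_ n = 0 -> x = 0) ->
  c_ 0%N * b = c_ 0%N -> (forall n, ring_eqv (a_ n.+1) (p_ n)) ->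
  ess_iso (left_ideal b) (prodset (left_ideal b) Z).
Proof.
move=> ca cp sZ Za cb ap.
have [w wP] := choice (fun n =>
  ring_eqv_normal (chain_idem ca n.+1) (chain_idem_d cp n) (ap n)).
have [z wz] := choice wP.
apply: (@ess_iso_absorb _ _ _ _ _ (fun n => rmul (w n))) => //.
- exact: submodule_left_ideal.
- move=> i x Zx; rewrite /left_ideal /= /rmul; have [_ _ <- _] := wz i.
  by rewrite -(chain_da_ge cp (leq0n i)).1 -!mulrA cb.
- move=> n x xZ sum0 i ni; apply: (Za _ i.+1) => //.
  have [<- _ _ _] := wz i; rewrite mulrA.
  suff -> : (x i : S) * w i = 0 by rewrite mul0r.
  have wp j : j != i -> w j * p_ i = 0.
    move=> ji; have [_ _ <- _] := wz j.
    by rewrite -mulrA (chain_dd cp ji) mulr0.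
  (* Right multiplication by [p_ i] isolates the [i]-th term of the relation. *)
  have : (\sum_(j < n) rmul (w j) (x j) : S) * p_ i = 0 by rewrite sum0 mul0r.
  rewrite mulr_suml (bigD1 (Ordinal ni)) //= big1 ?addr0.
    by rewrite /rmul -mulrA; have [_ _ -> _] := wz i.
  by move=> j ji; rewrite /rmul -mulrA wp ?mulr0.
Qed.

(** [Z] is the remainder of the chain: a complement of [chain_sum a_] in [S a_0]. An element of [Z]
    killed by some [a_n] lies in the chain sum, hence is zero. *)
Lemma ess_iso_chain_complement (a_ d_ : nat -> S) : chain a_ d_ ->
  exists Z : set S^o, [/\ submodule Z,
    ess_iso (left_ideal (a_ 0%N)) (prodset (chain_sum a_) Z)
    & forall (x : S^o) n, Z x -> (x : S) * a_ n = 0 -> x = 0].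
Proof.
move=> ca; have sA := submodule_left_ideal (a_ 0%N).
have sD := submodule_chain_sum ca.
have [Z [sZ ZA ZD ZDA]] := complement_exists sA sD.
exists Z; split=> //; last first.
  by move=> x n Zx xn; apply: ZD => //; split; [apply: ZA|exists n].
apply: ess_iso_direct_sum => //; first by move=> x [].
  by move=> x Dx /ZD; apply.
apply: essentialW ZDA => x [y [z [Zy Dz ->]]].
by exists z, y; rewrite addrC.
Qed.

(** The roles cross: the chain under [a_0] has pieces [q_n] equivalent to [b_(n+1)], so [S a_0]
    absorbs the remainder [B], while the pieces [p_n] under [b_0] let [S b_0] absorb [A]. *)
Lemma ess_iso_chains (a_ d_ b_ e_ ca_ q_ cb_ p_ : nat -> S) :
  chain a_ d_ -> chain b_ e_ -> chain ca_ q_ -> chain cb_ p_ ->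
  ca_ 0%N * a_ 0%N = ca_ 0%N -> cb_ 0%N * b_ 0%N = cb_ 0%N ->
  (forall n, ring_eqv (d_ n) (e_ n)) ->
  (forall n, ring_eqv (a_ n.+1) (p_ n)) ->
  (forall n, ring_eqv (b_ n.+1) (q_ n)) ->
  ess_iso (left_ideal (a_ 0%N)) (left_ideal (b_ 0%N)).
Proof.
move=> ca cb cq cp caa cbb de ap bq.
have [A [sA AD Aa]] := ess_iso_chain_complement ca.
have [B [sB BD Bb]] := ess_iso_chain_complement cb.
have Babs := ess_iso_absorb_chain ca cp sA Aa cbb ap.
have Aabs := ess_iso_absorb_chain cb cq sB Bb caa bq.
have DD := ess_iso_chain_sum ca cb de.
have sa := submodule_left_ideal (a_ 0%N).
have sb := submodule_left_ideal (b_ 0%N).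
have sD := submodule_chain_sum ca; have sE := submodule_chain_sum cb.
have sDA := submodule_prod sD sA; have sAB := submodule_prod sA sB.
have sBA := submodule_prod sB sA; have sEB := submodule_prod sE sB.
have rA := ess_iso_refl sA; have rB := ess_iso_refl sB.
apply: (ess_iso_trans Aabs).
apply: (ess_iso_trans (ess_iso_prod sa sB sDA sB AD rB)).
apply: (ess_iso_trans (ess_iso_sym (ess_iso_prodA sD sA sB))).
apply: (ess_iso_trans (ess_iso_prod sD sAB sE sBA DD (ess_iso_prodC sA sB))).
apply: (ess_iso_trans (ess_iso_prodA sE sB sA)).
apply: (ess_iso_trans (ess_iso_prod sEB sA sb sA (ess_iso_sym BD) rA)).
exact: ess_iso_sym.
Qed.

End Chains.

(** * Classes of direct summands of the ring *)

Section CyclicClasses.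
Variable S : pzRingType.
Hypothesis reg : von_neumann_regular S.
Implicit Types (e f a b c : S) (u v : Vmon S).

(* [v] is the class of [Se]. *)
Definition has_class e v :=
  e * e = e /\ exists i : e%:M *m e%:M = e%:M :> 'M[S]_1, v = Vcl (Idmx i).

Lemma mulmx11E (x y : 'M[S]_1) : (x *m y) 0 0 = x 0 0 * y 0 0.
Proof. by rewrite mxE big_ord1. Qed.

Lemma has_class_mx (m : 'M[S]_1) (i : m *m m = m) :
  has_class (m 0 0) (Vcl (Idmx i)).
Proof.
have mE := mx11_scalar m; split; first by rewrite -mulmx11E i.
have j : (m 0 0)%:M *m (m 0 0)%:M = (m 0 0)%:M :> 'M_1 by rewrite -mE.
by exists j; apply/VclP; exists m, m; rewrite /= -mE i.
Qed.

Lemma has_class_eqv e f u v : has_class e u -> has_class f v ->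
  u = v <-> ring_eqv e f.
Proof.
have scalar00 x : (x%:M : 'M[S]_1) 0 0 = x by rewrite mxE eqxx mulr1n.
move=> [ee [i ->]] [ff [j ->]]; rewrite VclP; split=> [[x [y [xy yx]]]|].
  exists (x 0 0), (y 0 0); rewrite -!mulmx11E.
  by split; rewrite (xy, yx) scalar00.
by case=> x [y [xy yx]]; exists x%:M, y%:M; rewrite -!scalar_mxM xy yx.
Qed.

Lemma has_class_split e u v : has_class e (u + v) ->
  exists m1 m2,
    [/\ orth_idem m1 m2, e = m1 + m2, has_class m1 u & has_class m2 v].
Proof.
case=> ee [i /esym/Vcl_split[m1 [m2 [i1 [i2 [[_ _ m12 m21] eE -> ->]]]]]].
exists (m1 0 0), (m2 0 0); split; try exact: has_class_mx.
  have m12' : m1 *m m2 = 0 := m12; have m21' : m2 *m m1 = 0 := m21.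
  by split; rewrite -mulmx11E ?i1 ?i2 ?m12' ?m21' ?mxE.
have := congr1 (fun x : 'M_1 => x 0 0) eE.
by rewrite !mxE eqxx mulr1n.
Qed.

Definition cyclic_class v := exists e, has_class e v.

Lemma cyclic_classDl u v : cyclic_class (u + v) -> cyclic_class u.
Proof. by case=> e /has_class_split[m1 [m2 [_ _ m1u _]]]; exists m1. Qed.

Fact idmx1_subproof n : 1%:M *m 1%:M = 1%:M :> 'M[S]_n.
Proof. exact: mulmx1. Qed.

(** The class of an idempotent of size [n] is below [n + 1] copies of the class of the ring; the
    extra copy keeps the list nonempty when [n = 0], as [alg_le_small_sum] requires. *)
Lemma cyclic_class_gen v : exists2 s : seq (Vmon S),
  (forall x, x \in s -> cyclic_class x) & v = \sum_(x <- s) x.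
Proof.
pose E n := Vcl (Idmx (@idmx1_subproof n)).
have E1 : cyclic_class (E 1%N).
  by exists 1; split; [rewrite mulr1|exists (@idmx1_subproof 1)].
have ES m n : E (m + n)%N = E m + E n.
  rewrite -VclD; apply/VclP; exists 1%:M, 1%:M.
  by rewrite /= mulmx1; split=> //; exact: scalar_mx_block.
have EE n : E n.+1 = \sum_(x <- nseq n.+1 (E 1%N)) x.
  elim: n => [|n IHn]; first by rewrite big_seq1.
  by rewrite [RHS]big_cons -[X in _ + X]IHn; apply: (ES 1%N).
have [[n e ei] ->] := Vcl_surj v.
apply: (alg_le_small_sum (V_refinement reg) cyclic_classDl
         (x := E 1%N) (s := nseq n (E 1%N))).
  by move=> y; rewrite -[_ :: _]/(nseq n.+1 _) => /nseqP[->].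
rewrite -[_ :: _]/(nseq n.+1 _) -EE (ES 1%N n).
have fi : (1%:M - e) *m (1%:M - e) = 1%:M - e.
  by rewrite mulmxBl mul1mx mulmxBr mulmx1 ei subrr subr0.
exists (Vcl (Idmx fi) + E 1%N).
rewrite addrA addrC; congr (_ + _); apply: Vcl_orth; last by rewrite addrC subrK.
have e1 : e *m (1%:M - e) = 0 by rewrite mulmxBr mulmx1 ei subrr.
have e2 : (1%:M - e) *m e = 0 by rewrite mulmxBl mul1mx ei subrr.
by split.
Qed.

Lemma realize_chain (mu nu : nat -> Vmon S) e : has_class e (nu 0%N) ->
  (forall n, nu n = mu n + nu n.+1) ->
  exists a_ d_ : nat -> S, [/\ a_ 0%N = e, chain a_ d_,
    forall n, has_class (a_ n) (nu n) & forall n, has_class (d_ n) (mu n)].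
Proof.
move=> e0 numu.
(* Dependent choice through a total [F]: the default [(0, 0)] serves pairs without the required
   class, which the iteration never meets by [aP]. *)
have /choice[F FP] : forall p : nat * S, exists q : S * S,
    has_class p.2 (nu p.1) -> [/\ orth_idem q.1 q.2, p.2 = q.1 + q.2,
      has_class q.1 (mu p.1) & has_class q.2 (nu p.1.+1)].
  move=> [n a] /=; have [na|] := pselect (has_class a (nu n)).
    move: (na); rewrite numu => /has_class_split[m1 [m2 m12]].
    by exists (m1, m2).
  by move=> na; exists (0, 0).
pose a_ := fix a_ n := if n is m.+1 then (F (m, a_ m)).2 else e.
have aP n : has_class (a_ n) (nu n).
  by elim: n => //= n IHn; have [] := FP (n, a_ n) IHn.
exists a_, (fun n => (F (n, a_ n)).1); split=> // n.
  by have [] := FP (n, a_ n) (aP n).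
by have [] := FP (n, a_ n) (aP n).
Qed.

(** Refining [a + c = b + c] writes [c] both as [a' + c'] and as [b' + c'], an equation of the same
    shape, so the step can be iterated. *)
Lemma refinement_sequence (V : nmodType) (a b c : V) : refinement V ->
  a + c = b + c -> exists a_ b_ c_ d_ : nat -> V,
  [/\ a_ 0%N = a, b_ 0%N = b, c_ 0%N = c & forall n,
    [/\ a_ n = d_ n + a_ n.+1, b_ n = d_ n + b_ n.+1,
        c_ n = a_ n.+1 + c_ n.+1 & c_ n = b_ n.+1 + c_ n.+1]].
Proof.
move=> refV abc.
have /choice[F FP] : forall p : V * V * V, exists dq : V * (V * V * V),
    p.1.1 + p.2 = p.1.2 + p.2 -> let: (d, q) := dq in
    [/\ p.1.1 = d + q.1.1, p.1.2 = d + q.1.2, p.2 = q.1.1 + q.2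
      & p.2 = q.1.2 + q.2].
  move=> [[x y] z] /=; have [xyz|] := pselect (x + z = y + z).
    have [d [x' [y' [z' [? ? ? ?]]]]] := refV _ _ _ _ xyz.
    by exists (d, (x', y', z')).
  by move=> nxyz; exists (0, (x, y, z)).
pose p := fix p n := if n is m.+1 then (F (p m)).2 else (a, b, c).
have pP n : (p n).1.1 + (p n).2 = (p n).1.2 + (p n).2.
  elim: n => //= n /FP; case: (F (p n)) => d q /= [_ _ <- <-].
  by [].
exists (fun n => (p n).1.1), (fun n => (p n).1.2), (fun n => (p n).2).
exists (fun n => (F (p n)).1); split=> // n /=.
by have := FP _ (pP n); case: (F (p n)).
Qed.

(** The form in which closure extension is used; [closure_extension_eqv] supplies it. *)
Hypothesis ess_iso_eqv : forall a b, a * a = a -> b * b = b ->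
  ess_iso (left_ideal a) (left_ideal b) -> ring_eqv a b.

(** The refinement sequence of classes is lifted to chains of idempotents in [S], and
    [ess_iso_chains] compares them. As [w] is below [u] and below [v], it is realised twice, by [ca]
    under [a] and by [cb] under [b]. *)
Lemma cyclic_class_sep (u v w : Vmon S) : cyclic_class (u + w) ->
  u + w = v + w -> alg_le w u -> alg_le w v -> u = v.
Proof.
move=> [h hu] uvw [u' uE] [v' vE].
have [a [_ [_ _ au _]]] := has_class_split hu.
move: (hu); rewrite uvw => /has_class_split[b [_ [_ _ bv _]]].
have [a_ [b_ [c_ [d_ [a0 b0 c0 abcd]]]]] :=
  refinement_sequence (V_refinement reg) uvw.
have [||aa [ad [aa0 cha aaP adP]]] := @realize_chain d_ a_ a.
- by rewrite a0.
- by move=> n; have [] := abcd n.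
have [||bb [bd [bb0 chb bbP bdP]]] := @realize_chain d_ b_ b.
- by rewrite b0.
- by move=> n; have [] := abcd n.
move: (au) (bv); rewrite {1}uE {1}vE.
move=> /has_class_split[ca [ca' [oa aE caw _]]].
move=> /has_class_split[cb [cb' [ob bE cbw _]]].
(* The copy of [w] under [a] is cut by the classes [b_ n.+1], the copy under [b] by the [a_ n.+1],
   as the crossed absorption demands. *)
have [||q [qd [q0 chq _ qdP]]] := @realize_chain (fun n => b_ n.+1) c_ ca.
- by rewrite c0.
- by move=> n; have [] := abcd n.
have [||p [pd [p0 chp _ pdP]]] := @realize_chain (fun n => a_ n.+1) c_ cb.
- by rewrite c0.
- by move=> n; have [] := abcd n.
apply/(has_class_eqv au bv); apply: ess_iso_eqv; [by case: au|by case: bv|].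
rewrite -aa0 -bb0; apply: (ess_iso_chains cha chb chq chp).
- by rewrite q0 aa0 aE mulrDr; have [-> _ -> _] := oa; rewrite addr0.
- by rewrite p0 bb0 bE mulrDr; have [-> _ -> _] := ob; rewrite addr0.
- by move=> n; apply/(has_class_eqv (adP n) (bdP n)).
- by move=> n; apply/(has_class_eqv (aaP n.+1) (pdP n)).
- by move=> n; apply/(has_class_eqv (bbP n.+1) (qdP n)).
Qed.

Lemma Vmon_separative (u v : Vmon S) :
  u + u = u + v -> u + v = v + v -> u = v.
Proof.
apply: (refinement_separative (V_refinement reg)
  cyclic_classDl cyclic_class_gen).
exact: cyclic_class_sep.
Qed.

End CyclicClasses.

(** * Closure extension and modules *)

Section ClosureExtension.
Variable R : pzRingType.
Hypothesis reg : von_neumann_regular R.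
Implicit Types (a b : R) (I J : set R).

(** [aR] is essentially closed: for [j] in an essential extension [J], put [y = j - a j = y z y]. An
    element [j z y r] of [I] is fixed by [a], so [y r = 0] and it vanishes; hence [j z y = 0] and
    [y = 0]. *)
Lemma essential_closure_summand a I : a * a = a -> right_ideal I ->
  I `<=` [set x | a * x = x] ->
  (forall x, a * x = x -> x != 0 -> exists r, x * r != 0 /\ I (x * r)) ->
  essential_closure I [set x | a * x = x].
Proof.
move=> aa [I0 ID IM] Ia Iess; split.
- split; first by rewrite /= mulr0.
    by move=> x y /= ax ay; rewrite mulrDr ax ay.
  by move=> x r /= ax; rewrite mulrA ax.
- split=> // K [K0 KD KM] Ka IK; apply/seteqP; split=> [x Kx|_ -> //].
  apply: contrapT => /eqP x0; have [r [/eqP xr0 Ixr]] := Iess x (Ka x Kx) x0.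
  have : (I `&` K) (x * r) by split=> //; apply: KM.
  by rewrite IK.
- move=> J [J0 JD JM] [IJ Jess] j Jj.
  have [y yE] : exists y, y = j - a * j by exists (j - a * j).
  have ay0 x : a * x = x -> x - a * x = 0 by move=> ->; rewrite subrr.
  have [z yzy] := reg y.
  have yr r : j * z * y * r - a * (j * z * y * r) = y * r.
    by rewrite !mulrA -!mulrBl -yE -yzy.
  have /seteqP[/(_ (j * z * y)) jzy _] :
      [set x | exists r, x = j * z * y * r] = [set 0].
    apply: Jess.
    - split; first by exists 0; rewrite mulr0.
        by move=> _ _ [r ->] [s ->]; exists (r + s); rewrite mulrDr.
      by move=> _ s [r ->]; exists (r * s); rewrite mulrA.
    - by move=> _ [r ->]; rewrite -!mulrA; apply: JM.
    - apply/seteqP; split=> [x [Ix [r xE]]|_ ->]; last first.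
        by split=> //; exists 0; rewrite mulr0.
      have yr0 : y * r = 0 by rewrite -yr -xE ay0 //; apply: Ia.
      by rewrite /= xE -mulrA yr0 mulr0.
  have y0 : y = 0.
    rewrite -[y]mulr1 -yr mulr1 jzy ?mulr0 ?subrr //.
    by exists 1; rewrite mulr1.
  by apply/esym/subr0_eq; rewrite -yE.
Qed.

(** The witnesses are the image [g a] of one generator and the preimage [y] of the other, [b]. *)
Lemma right_ideal_iso_summand a b g : a * a = a -> b * b = b ->
  right_ideal_iso [set x | a * x = x] [set x | b * x = x] g ->
  exists x y, x * y = b /\ y * x = a.
Proof.
move=> aa bb [gD gM [gfun ginj gsurj]].
have ina c : a * c = c -> c \in [set x | a * x = x].
  by move=> ac; apply: mem_set.
have [y /= ay gy] := gsurj b bb.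
have gab := gfun a aa; rewrite /= in gab.
have gaa : g a * a = g a by rewrite -gM ?aa //; apply: ina.
have yb : y * b = y.
  apply: ginj; [by apply: ina; rewrite mulrA ay|exact: ina|].
  by rewrite gM ?ina // gy.
exists (g a), y; split.
  by rewrite -gM ?ina // ay.
apply: ginj; [by apply: ina; rewrite mulrA ay|exact: ina|].
by rewrite gM ?ina // gy.
Qed.

(** Left ideals of [R^c] are right ideals of [R]. The partial isomorphism joins essential submodules
    of [aR] and [bR], which are their essential closures, so it extends to an isomorphism of [aR]
    with [bR]. *)
Lemma closure_extension_eqv : closure_extension_property R ->
  forall a b : R^c, a * a = a -> b * b = b ->
  ess_iso (left_ideal a) (left_ideal b) -> ring_eqv a b.
Proof.
move=> cep a b aa bb [H [[H0 HD HZ Hl Hr] HAB HA HB]].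
pose G : R -> R -> Prop := H.
have GD (x y x' y' : R) : G x y -> G x' y' -> G (x + x') (y + y') :=
  @HD x y x' y'.
have GM (x y r : R) : G x y -> G (x * r) (y * r) := @HZ r x y.
pose I : set R := [set x | exists y, G x y].
pose J : set R := [set y | exists x, G x y].
have GB' (x y x' y' : R) : G x y -> G x' y' -> G (x - x') (y - y').
  move=> xy xy'; have := GM _ _ (-1) xy'; rewrite !mulrN1 => xy'N.
  exact: GD.
have [f fP] : {f : R -> R & forall x, I x -> G x (f x)}.
  apply: (@choice R R (fun x y => I x -> G x y)) => x.
  by have [[y xy]|nIx] := pselect (I x); [exists y|exists 0].
have Guniq (x y y' : R) : G x y -> G x y' -> y = y'.
  by move=> xy xy'; apply/subr0_eq/Hr; rewrite -(subrr x); apply: GB'.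
have Ginj (x x' y : R) : G x y -> G x' y -> x = x'.
  by move=> xy xy'; apply/subr0_eq/Hl; rewrite -(subrr y); apply: GB'.
have rI : right_ideal I.
  split; first by exists 0.
    by move=> x x' [y xy] [y' xy']; exists (y + y'); apply: GD.
  by move=> x r [y xy]; exists (y * r); apply: GM.
have rJ : right_ideal J.
  split; first by exists 0.
    by move=> y y' [x xy] [x' xy']; exists (x + x'); apply: GD.
  by move=> y r [x xy]; exists (x * r); apply: GM.
have fiso : right_ideal_iso I J f.
  have [_ ID IM] := rI; split.
  - move=> x x' /set_mem Ix /set_mem Ix'.
    apply: (Guniq (x + x')); first by apply: fP; apply: ID.
    by apply: GD; apply: fP.
  - move=> x /set_mem Ix r.
    apply: (Guniq (x * r)); first by apply: fP; apply: IM.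
    by apply: GM; apply: fP.
  - split.
    + by move=> x /fP; exists x.
    + move=> x x' /set_mem /fP xy /set_mem /fP; rewrite -[f x']/(f x').
      by move=> + fx; rewrite -fx; apply: Ginj.
    + move=> y [x xy]; have Ix : I x by exists y.
      by exists x => //; apply: Guniq xy; apply: fP.
have cI : essential_closure I [set x : R | (a : R) * x = x].
  by apply: essential_closure_summand => // x [y /HAB[]].
have cJ : essential_closure J [set x : R | (b : R) * x = x].
  by apply: essential_closure_summand => // y [x /HAB[]].
have [g giso _] := cep I J f rI rJ fiso _ _ cI cJ.
(* Products in [R^c] are reversed, which exchanges the two equations. *)
by have [x [y [xy yx]]] := right_ideal_iso_summand aa bb giso; exists x, y.
Qed.

End ClosureExtension.

(** * From modules to idempotent matrices *)

Section Modules.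
Variable S : pzRingType.
Implicit Types M N : lmodType S.

Lemma linear_of_fun M N (f : M -> N) : linear f ->
  exists g : {linear M -> N}, g =1 f.
Proof.
move=> lf; pose g : {linear M -> N} :=
  HB.pack_for {linear M -> N} f (GRing.isLinear.Build S M N *:%R f lf).
by exists g.
Qed.

(* [M] is the image of the idempotent matrix [e] acting on row vectors. *)
Definition represents M (e : idmx S) :=
  exists (p : {linear 'rV[S]_(idim e) -> M})
    (s : {linear M -> 'rV[S]_(idim e)}),
    cancel s p /\ forall u, s (p u) = u *m imx e.

Lemma represents_prod M N e f : represents M e -> represents N f ->
  represents (M * N)%type (idmx_sum e f).
Proof.
move=> [p [s [sp ps]]] [q [t [tq qt]]].
have [|P PE] := @linear_of_fun 'rV[S]_(idim (idmx_sum e f)) (M * N)%type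
  (fun u => (p (lsubmx u), q (rsubmx u))).
  by move=> r u v; rewrite !linearP.
have [|T TE] := @linear_of_fun (M * N)%type 'rV[S]_(idim (idmx_sum e f))
  (fun w => row_mx (s w.1) (t w.2)).
  by move=> r u v; rewrite /= !linearP scale_row_mx add_row_mx.
exists P, T; split=> [[x y]|u]; rewrite PE TE /=.
  by rewrite row_mxKl row_mxKr sp tq.
rewrite ps qt -[u in RHS]hsubmxK mul_row_block !mulmx0 addr0 add0r.
by [].
Qed.

Lemma mx_of_linear m n (f : {linear 'rV[S]_m -> 'rV[S]_n}) :
  exists A, forall u, f u = u *m A.
Proof. by exists (lin1_mx f) => u; rewrite mul_rV_lin1. Qed.

Lemma mx_eq_act m n (A B : 'M[S]_(m, n)) :
  (forall u : 'rV_m, u *m A = u *m B) -> A = B.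
Proof. by move=> AB; apply/row_matrixP => i; rewrite !rowE. Qed.

(** [x] and [y] are the matrices of [phi] and its inverse carried to row vectors by the
    representations; the composites are [s p] and [t q], that is, [e] and [f]. *)
Lemma iso_represents M N e f (phi : {linear M -> N}) : bijective phi ->
  represents M e -> represents N f -> idmx_eqv e f.
Proof.
move=> [psi phiK psiK] [p [s [sp ps]]] [q [t [tq qt]]].
have [|psi' psiE] := @linear_of_fun N M psi.
  by move=> r u v; apply: (can_inj phiK); rewrite psiK linearP !psiK.
have [|F FE] := @linear_of_fun _ _ (fun u => t (phi (p u))).
  by move=> r u v; rewrite !linearP.
have [|G GE] := @linear_of_fun _ _ (fun u => s (psi' (q u))).
  by move=> r u v; rewrite !linearP.
have [x xP] := mx_of_linear F; have [y yP] := mx_of_linear G.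
exists x, y; split; apply: mx_eq_act => u; rewrite mulmxA.
  by rewrite -xP -yP FE GE tq psiE phiK ps.
by rewrite -yP -xP FE GE sp psiE psiK qt.
Qed.

Lemma represents_iso M N e f : represents M e -> represents N f ->
  idmx_eqv e f -> exists phi : {linear M -> N}, bijective phi.
Proof.
move=> [p [s [sp ps]]] [q [t [tq qt]]] [x [y [xy yx]]].
have [|phi phiE] := @linear_of_fun M N (fun m => q (s m *m x)).
  by move=> r u v; rewrite linearP mulmxDl -scalemxAl linearP.
exists phi; exists (fun n => p (t n *m y)) => [m|n]; rewrite phiE.
  rewrite qt -yx !mulmxA -[_ *m x *m y]mulmxA xy -[_ *m x *m y]mulmxA xy.
  by rewrite -mulmxA imxP -ps !sp.
rewrite ps -xy !mulmxA -[_ *m y *m x]mulmxA yx -[_ *m y *m x]mulmxA yx.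
by rewrite -mulmxA imxP -qt !tq.
Qed.

End Modules.

(** Generators give a surjection [p] from a free module, and lifting the identity along it gives a
    section [s]; the matrix of [s p] is idempotent because [p s] is the identity. *)
Lemma fgp_represented (R : pzRingType) (M : rmodType R) :
  finitely_generated M -> projective M -> exists e, represents M e.
Proof.
move=> [n [v vP]] projM.
have [|p pE] := @linear_of_fun R^c 'rV[R^c]_n M
  (fun u => \sum_(i < n) u 0 i *: v i).
  move=> r x y; rewrite scaler_sumr -big_split; apply: eq_bigr => i _ /=.
  by rewrite !mxE scalerDl scalerA.
have [|i iE] := @linear_of_fun R^c M M id; first by [].
have [x|s sP] := projM _ _ p i.
  have [c ->] := vP x; exists (\row_j c j); rewrite pE.
  by apply: eq_bigr => j _; rewrite mxE.
have ps m : p (s m) = m by rewrite sP iE.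
have [|F FE] := @linear_of_fun _ _ _ (fun u => s (p u)).
  by move=> r u w; rewrite !linearP.
have [e eP] := mx_of_linear F.
have ee : e *m e = e.
  by apply: mx_eq_act => u; rewrite mulmxA -!eP !FE ps.
by exists (Idmx ee), p, s; split=> // u; rewrite -eP FE.
Qed.

Theorem proposition2p9 (R : pzRingType) :
  von_neumann_regular R ->
  closure_extension_property R ->
  separative R.
Proof.
move=> reg cep M N fgM pM fgN pN [phi phib] [psi psib].
have [e Me] := fgp_represented fgM pM; have [f Nf] := fgp_represented fgN pN.
apply: (represents_iso Me Nf); apply/VclP.
(* Right [R]-modules are left [R^c]-modules, so the theory above is applied with [S = R^c]. *)
have regc : von_neumann_regular R^c.
  by move=> a; have [b ab] := reg a; exists b; rewrite -mulrA.
have MN : Vcl (idmx_sum e f) = Vcl (idmx_sum e e).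
  apply/VclP; apply: (iso_represents phib); exact: represents_prod.
apply: (Vmon_separative regc (closure_extension_eqv reg cep)).
  by rewrite -!VclD MN.
rewrite -!VclD MN; apply/VclP.
by apply: (iso_represents psib); apply: represents_prod.
Qed.
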